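(* Let $\theta$ be an irrational number whose continued fraction expansion is $\theta=[0;1,1,a_3,a_4,\dots]$ (that is, $a_0=0$, $a_1=a_2=1$), and let $Q_\nu$ denote the denominators of its convergents. Suppose that $$\lim_{\nu\to\infty}\frac{Q_{\nu-1}}{a_{\nu+1}}=0.$$ Then there exists a continuous $1$-periodic function $g_\theta:\mathbb{R}\to\mathbb{R}$ of bounded variation with $\int_0^1 g_\theta(x)\,dx=0$ such that $$\liminf_{\nu\to\infty}\sum_{k=0}^{Q_\nu-1} g_\theta(k\theta)>0 .$$
   Context: Every irrational $\theta$ has a unique continued fraction expansion $\theta=[a_0;a_1,a_2,\dots]$ with $a_0\in\mathbb{Z}$ and $a_\nu$ positive integers for $\nu\ge1$; the convergents are $P_\nu/Q_\nu=[a_0;a_1,\dots,a_\nu]$ in lowest terms with $Q_\nu>0$. *)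

(* Defs.v *)
From mathcomp Require Import all_boot all_order all_algebra.
From mathcomp Require Import all_classical all_reals all_analysis.
Import Order.TTheory GRing.Theory Num.Theory.
Import numFieldNormedType.Exports.

Set Implicit Arguments.
Unset Strict Implicit.
Unset Printing Implicit Defensive.

Local Open Scope classical_set_scope.
Local Open Scope ring_scope.

Fixpoint cfrac (a : nat -> int) (n : nat) : rat :=
  if n is m.+1 then (a 0%N)%:Q + (cfrac (fun i => a i.+1) m)^-1
  else (a 0%N)%:Q.

Definition is_cfrac_expansion (R : realType) (theta : R) (a : nat -> int) :=
  (forall n : nat, (0 < n)%N -> 0 < a n) /\
  (ratr (cfrac a n) : R) @[n --> \oo] --> theta.

(* The denominator of the n-th convergent in lowest terms; denq is always
   positive, so the absolute value only changes the type to nat. *)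
Definition cfrac_den (a : nat -> int) (n : nat) : nat := `|denq (cfrac a n)|%N.

(* Main.v *)
Require Import Defs.
From mathcomp Require Import all_boot all_order all_algebra.
From mathcomp Require Import all_classical all_reals all_analysis.
From mathcomp Require Import ring lra.
Import Order.TTheory GRing.Theory Num.Theory.
Import numFieldNormedType.Exports.

Local Open Scope classical_set_scope.
Local Open Scope ring_scope.

(** The function is g(x) = F(x) - x - const, where F is a devil's staircase with
    F(x + 1) = F(x) + 1 which, for every large denominator Q = Q_nu, is constant
    on each interval [(j - 1/16)/Q, (j + 11/16)/Q].  The points k theta, k < Q,
    are so close to the points j/Q that F takes the same values on both, so the
    Birkhoff sum is \sum_j F(j/Q) - Q \int_0^1 F + 1/2 up to 1/200.  Since F
    increases only on the last 5/16 of [j/Q, (j+1)/Q], the integral satisfies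
    Q \int_0^1 F <= \sum_j F(j/Q) + 5/16, which leaves a positive sum.

    F is the limit of compositions of degree-one maps x |-> phi(Q_nu x) / Q_nu,
    where phi is constant on [j - 1/8, j + 3/4] and has slope 8 elsewhere.  The
    limit exists, and the plateaux of each scale survive the smaller scales,
    because the hypothesis forces Q_(nu+1) >= 100 Q_nu eventually. *)

(** * Continued fractions: numerators and denominators of convergents *)

Fixpoint convergent (a : nat -> int) (n : nat) : int * int :=
  if n is m.+1 then
    let c := convergent (fun i => a i.+1) m in (a 0%N * c.1 + c.2, c.1)
  else (a 0%N, 1).

Lemma convergent_numS (a : nat -> int) (n : nat) :
  (convergent a n.+1).1 = a 0%N * (convergent (fun i => a i.+1) n).1
                            + (convergent (fun i => a i.+1) n).2.
Proof. by []. Qed.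

Lemma convergent_denS (a : nat -> int) (n : nat) :
  (convergent a n.+1).2 = (convergent (fun i => a i.+1) n).1.
Proof. by []. Qed.

(** [convergent] peels off a_0, as [cfrac] does. The recurrence at the other end follows because
    passing to the shifted sequence is linear in the pair, with coefficients independent of n. *)
Lemma convergentSS (n : nat) (a : nat -> int) :
  (convergent a n.+2).1
    = a n.+2 * (convergent a n.+1).1 + (convergent a n).1 /\
  (convergent a n.+2).2
    = a n.+2 * (convergent a n.+1).2 + (convergent a n).2.
Proof.
elim: n a => [|n IHn] a; first by rewrite /=; split; ring.
have [IH1 IH2] := IHn (fun i => a i.+1).
rewrite !(convergent_numS a) !(convergent_denS a) IH1 IH2.
by split; ring.
Qed.

(** Prepending a_0 multiplies the matrix of two successive pairs by one of determinant -1, so each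
    shift of the sequence flips the sign. *)
Lemma convergent_det (n : nat) (a : nat -> int) :
  (convergent a n.+1).1 * (convergent a n).2
    - (convergent a n).1 * (convergent a n.+1).2 = (-1) ^+ n.
Proof.
elim: n a => [|n IHn] a; first by rewrite /= expr0; ring.
rewrite !(convergent_numS a) !(convergent_denS a) exprS.
by rewrite -(IHn (fun i => a i.+1)); ring.
Qed.

(** Meant for the shifted sequence, whose numerators are the denominators of the original one; a_0
    itself may be zero or negative. *)
Lemma convergent_gt0 (n : nat) (a : nat -> int) :
  (forall i, 0 < a i) -> 0 < (convergent a n).1 /\ 0 < (convergent a n).2.
Proof.
elim: n a => [|n IHn] a a_gt0; first by split; rewrite //=.
have [p_gt0 q_gt0] := IHn (fun i => a i.+1) (fun i => a_gt0 i.+1).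
by rewrite convergent_numS convergent_denS addr_gt0 ?mulr_gt0.
Qed.

Section positive_quotients.
Variables (a : nat -> int) (a_gt0 : forall n : nat, (0 < n)%N -> 0 < a n).

Let p n := (convergent a n).1.
Let q n := (convergent a n).2.

Lemma convergent_den_gt0 (n : nat) : 0 < q n.
Proof.
case: n => [//|n]; rewrite /q convergent_denS.
by case: (convergent_gt0 n (fun i => a i.+1) (fun i => a_gt0 i.+1 isT)).
Qed.

Lemma cfrac_convergent (n : nat) : cfrac a n = (p n)%:~R / (q n)%:~R.
Proof.
rewrite /p /q; elim: n a a_gt0 => [|n IHn] b b_gt0; first by rewrite /= divr1.
have [p_gt0 _] := convergent_gt0 n (fun i => b i.+1) (fun i => b_gt0 i.+1 isT).
rewrite [LHS]/= IHn; last by move=> i _; exact: b_gt0.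
rewrite convergent_numS convergent_denS rmorphD rmorphM /= invf_div mulrDl.
by rewrite mulfK// intr_eq0 gt_eqF.
Qed.

Lemma convergent_coprime (n : nat) : coprime `|p n| `|q n|.
Proof.
(* The Bezout coefficients are read off [convergent_det], multiplied by its sign. *)
apply/coprimezP; exists ((-1) ^+ n.+1 * q n.+1, (-1) ^+ n * p n.+1) => /=.
rewrite exprS -!mulrA mulN1r addrC -mulrBr [p n.+1 * _]/=.
rewrite [q n.+1 * _]mulrC convergent_det -exprD addnn -mul2n exprM.
by rewrite sqrrN !expr1n.
Qed.

Lemma cfrac_denE (n : nat) : (cfrac_den a n)%:Z = q n.
Proof.
rewrite /cfrac_den cfrac_convergent coprimeq_den ?convergent_coprime//.
by rewrite gt_eqF ?convergent_den_gt0//= gtz0_abs// convergent_den_gt0.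
Qed.

Lemma cfrac_numE (n : nat) : numq (cfrac a n) = p n.
Proof.
rewrite cfrac_convergent coprimeq_num ?convergent_coprime//.
by rewrite gtr0_sg ?mul1r// convergent_den_gt0.
Qed.

(** As functions of k, the signed difference inside the norm and q_(n+k) satisfy the same recurrence
    with positive coefficients. The triangle inequality thus propagates the bound from k = 0 and k =
    1. *)
Lemma convergent_dist (n k : nat) :
  q n.+1 * `|p (n + k)%N * q n - p n * q (n + k)%N| <= q (n + k)%N.
Proof.
elim/ltn_ind: k => -[|[|k]] IHk.
- by rewrite addn0 subrr normr0 mulr0 ltW ?convergent_den_gt0.
- by rewrite addn1 convergent_det normrX normrN1 expr1n mulr1.
have := IHk k (ltnW (leqnn _)); have := IHk k.+1 (leqnn _).
have [pE qE] := convergentSS (n + k) a.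
have q_gt0 := convergent_den_gt0 n.+1.
rewrite !addnS -/(p _) -/(q _) in pE qE *.
rewrite pE qE => IH1 IH0.
have b_gt0 := a_gt0 (n + k).+2 isT.
set b := a _ in pE qE b_gt0 *.
set x := p (n + k).+1 * q n - p n * q (n + k).+1 in IH1.
set y := p (n + k)%N * q n - p n * q (n + k)%N in IH0.
have -> : (b * p (n + k).+1 + p (n + k)%N) * q n
    - p n * (b * q (n + k).+1 + q (n + k)%N) = b * x + y by rewrite /x /y; ring.
apply: (@le_trans _ _ (q n.+1 * (b * `|x| + `|y|))).
  rewrite ler_pM2l// (le_trans (ler_normD _ _))// normrM gtr0_norm//.
by rewrite mulrDr mulrCA lerD// ler_pM2l.
Qed.

End positive_quotients.

Lemma cfrac_den_gt0 (a : nat -> int) (n : nat) : (0 < cfrac_den a n)%N.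
Proof. by rewrite /cfrac_den absz_gt0 denq_neq0. Qed.

Lemma cfrac_den_growth (a : nat -> int) (n : nat) :
  (forall m : nat, (0 < m)%N -> 0 < a m) ->
  a n.+1 * (cfrac_den a n)%:Z <= (cfrac_den a n.+1)%:Z.
Proof.
move=> a_gt0; rewrite !cfrac_denE//; case: n => [|n]; first by rewrite /= mulr1.
have [_ ->] := convergentSS n a.
by rewrite lerDl ltW ?convergent_den_gt0.
Qed.

Lemma coprime_numq_cfrac_den (a : nat -> int) (n : nat) :
  coprime `|numq (cfrac a n)| (cfrac_den a n).
Proof. exact: coprime_num_den. Qed.

(** Divided by the denominators, [convergent_dist] bounds the distance from the n-th to the m-th
    convergent by a quantity free of m, so the bound passes to the limit in m. *)
Lemma cfrac_approx (R : realType) (theta : R) (a : nat -> int) (n : nat) :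
  is_cfrac_expansion theta a ->
  `|theta - (numq (cfrac a n))%:~R / (cfrac_den a n)%:R|
    <= ((cfrac_den a n)%:R * (cfrac_den a n.+1)%:R)^-1.
Proof.
move=> [a_gt0 a_cvg].
have ratrE m : (ratr (cfrac a m) : R)
    = (numq (cfrac a m))%:~R / (cfrac_den a m)%:R.
  rewrite /ratr; congr (_ / _).
  by rewrite /cfrac_den -[in LHS](gtz0_abs (denq_gt0 _)).
rewrite -ratrE.
have : `|ratr (cfrac a m) - ratr (cfrac a n)| @[m --> \oo]
    --> `|theta - ratr (cfrac a n)|.
  by apply: cvg_norm; apply: cvgB => //; exact: cvg_cst.
move=> dist_cvg; rewrite -(cvg_lim _ dist_cvg)//.
apply: limr_le; first by apply/cvg_ex; exists `|theta - ratr (cfrac a n)|.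
near=> m.
have le_nm : (n <= m)%N by near: m; exact: nbhs_infty_ge.
have den_gt0 k : 0 < (cfrac_den a k)%:R :> R by rewrite ltr0n cfrac_den_gt0.
have := convergent_dist a a_gt0 n (m - n)%N.
rewrite subnKC// -(ler_int R) intrM intr_norm intrB !intrM.
rewrite -!(cfrac_numE a a_gt0) -!(cfrac_denE a a_gt0) -!pmulrn => dist_le.
rewrite !ratrE -mulNr addf_div ?gt_eqF// mulNr normrM normfV.
rewrite [X in _ / X]gtr0_norm ?mulr_gt0//.
rewrite ler_pdivrMr ?mulr_gt0//.
move: (dist_le) (den_gt0 n) (den_gt0 n.+1) (den_gt0 m).
set P := (numq (cfrac a m))%:~R; set p := (numq (cfrac a n))%:~R.
set Q := (cfrac_den a m)%:R; set q := (cfrac_den a n)%:R.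
set q' := (cfrac_den a n.+1)%:R => {}dist_le q_gt0 q'_gt0 Q_gt0.
have -> : (q * q')^-1 * (Q * q) = q'^-1 * Q by field; lra.
by rewrite ler_pdivlMl.
Unshelve. all: by end_near. Qed.

(** * The one-scale maps with plateaux at the integers *)

Section devil_staircase.
Context {R : realType}.
Implicit Types x y : R.

(** With u = x + 1/8 - m in [0, 1), the ramp 8u - 7 is positive only for u > 7/8 and tends to 1 as u
    tends to 1, so successive cells fit together continuously. *)
Definition plateau x : R :=
  let m := Num.floor (x + 8^-1) in m%:~R + Num.max 0 (8 * (x + 8^-1 - m%:~R) - 7).

Lemma plateau_lip x y : x <= y ->
  plateau x <= plateau y <= plateau x + 8 * (y - x).
Proof.
move=> le_xy; rewrite /plateau.
set m := Num.floor (x + _); set n := Num.floor (y + _).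
have /andP[mx xm] : m%:~R <= x + 8^-1 < m%:~R + 1.
  by rewrite /m -intrD1 floor_itv// num_real.
have /andP[ny yn] : n%:~R <= y + 8^-1 < n%:~R + 1.
  by rewrite /n -intrD1 floor_itv// num_real.
have : (m <= n)%R by rewrite floor_ge_int; lra.
rewrite le_eqVlt => /predU1P[mn|].
  rewrite -mn in ny yn *.
  by case: (leP 0 (8 * (x + _ - _) - 7)); case: (leP 0 (8 * (y + _ - _) - 7));
    move=> *; apply/andP; split; lra.
rewrite -lezD1 -(ler_int R) intrD1 => lt_mn.
by case: (leP 0 (8 * (x + _ - _) - 7)); case: (leP 0 (8 * (y + _ - _) - 7));
  move=> *; apply/andP; split; lra.
Qed.

Lemma plateauD (k : int) x : plateau (x + k%:~R) = plateau x + k%:~R.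
Proof.
rewrite /plateau addrAC floorDrz ?intr_int// intrKfloor intrD.
set f := (Num.floor _)%:~R; have -> : x + 8^-1 + k%:~R - (f + k%:~R) = x + 8^-1 - f.
  by ring.
by rewrite addrAC.
Qed.

Lemma plateau_dist x : `|plateau x - x| <= 1.
Proof.
rewrite /plateau; set m := Num.floor _.
have /andP[mx xm] : m%:~R <= x + 8^-1 < m%:~R + 1.
  by rewrite /m -intrD1 floor_itv// num_real.
by rewrite ler_norml; case: (leP 0 (8 * _ - 7)) => *; apply/andP; split; lra.
Qed.

Lemma plateau_int (j : int) x :
  j%:~R - 8^-1 <= x <= j%:~R + 3 / 4 -> plateau x = j%:~R.
Proof.
move=> /andP[jx xj]; rewrite /plateau.
have -> : Num.floor (x + 8^-1) = j.
  by apply/floor_def; rewrite intrD1; apply/andP; split; lra.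
by case: (leP 0 (8 * _ - 7)) => *; lra.
Qed.

Definition scaled_plateau (q : nat) x : R := plateau (q%:R * x) / q%:R.

Lemma scaled_plateau_lip (q : nat) x y : (0 < q)%N -> x <= y ->
  scaled_plateau q x <= scaled_plateau q y <= scaled_plateau q x + 8 * (y - x).
Proof.
move=> q_gt0 le_xy; have q0 : 0 < q%:R :> R by rewrite ltr0n.
have /andP[] : plateau (q%:R * x) <= plateau (q%:R * y)
    <= plateau (q%:R * x) + 8 * (q%:R * y - q%:R * x).
  by apply: plateau_lip; rewrite ler_pM2l.
rewrite /scaled_plateau => le1 le2; rewrite ler_pM2r ?invr_gt0// le1/=.
by rewrite ler_pdivrMr// mulrDl divfK ?gt_eqF// -mulrA [_ * q%:R]mulrC mulrBr.
Qed.

Lemma scaled_plateauD1 (q : nat) x : (0 < q)%N ->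
  scaled_plateau q (x + 1) = scaled_plateau q x + 1.
Proof.
move=> q_gt0; have q0 : q%:R != 0 :> R by rewrite pnatr_eq0 -lt0n.
rewrite /scaled_plateau mulrDr mulr1.
by have := plateauD q (q%:R * x); rewrite -pmulrn => ->; rewrite mulrDl divff.
Qed.

Lemma scaled_plateau_dist (q : nat) x : (0 < q)%N ->
  `|scaled_plateau q x - x| <= q%:R^-1.
Proof.
move=> q_gt0; have q0 : 0 < q%:R :> R by rewrite ltr0n.
have -> : scaled_plateau q x - x = (plateau (q%:R * x) - q%:R * x) / q%:R.
  by rewrite /scaled_plateau; field; lra.
by rewrite normrM normfV (gtr0_norm q0) ler_piMl ?invr_ge0 ?ler0n ?plateau_dist.
Qed.

Lemma scaled_plateau_int (q : nat) (j : int) x : (0 < q)%N ->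
  (j%:~R - 8^-1) / q%:R <= x <= (j%:~R + 3 / 4) / q%:R ->
  scaled_plateau q x = j%:~R / q%:R.
Proof.
move=> q_gt0; have q0 : 0 < q%:R :> R by rewrite ltr0n.
rewrite ler_pdivrMr// ler_pdivlMr// ![x * _]mulrC => jx.
by rewrite /scaled_plateau (plateau_int _ _ jx).
Qed.

(** * Composition over all scales and its limit *)

Section limit.
Variable q : nat -> nat.
Hypothesis q_gt0 : forall n, (0 < q n)%N.
Hypothesis q_growth : forall n, (100 * q n <= q n.+1)%N.

Let q0 n : 0 < (q n)%:R :> R. Proof. by rewrite ltr0n. Qed.

Let qS n : 100 * (q n)%:R <= (q n.+1)%:R :> R.
Proof. by rewrite -natrM ler_nat. Qed.

(** The finest scale acts first: a new map moves the argument by at most 1/q_n before the earlier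
    maps stretch that error by at most 8^n. *)
Fixpoint staircase (n : nat) x : R :=
  if n is m.+1 then staircase m (scaled_plateau (q m) x) else x.

Lemma staircase_lip (n : nat) x y : x <= y ->
  staircase n x <= staircase n y <= staircase n x + 8 ^+ n * (y - x).
Proof.
elim: n x y => [|n IHn] x y le_xy /=.
  by rewrite le_xy expr0 mul1r addrC subrK lexx.
have /andP[le1 le2] := scaled_plateau_lip _ _ _ (q_gt0 n) le_xy.
have /andP[-> /le_trans->//] := IHn _ _ le1.
by rewrite lerD2l exprSr -mulrA ler_pM2l ?exprn_gt0// lerBlDl.
Qed.

Lemma staircase_dist (n : nat) x y :
  `|staircase n x - staircase n y| <= 8 ^+ n * `|x - y|.
Proof.
wlog le_yx : x y / y <= x.
  move=> wlg; have [/wlg//|/ltW/wlg] := leP y x.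
  by rewrite distrC [`|y - x|]distrC.
have /andP[le1 le2] := staircase_lip n _ _ le_yx.
by rewrite !ger0_norm ?subr_ge0// lerBlDl.
Qed.

Lemma staircaseD1 (n : nat) x : staircase n (x + 1) = staircase n x + 1.
Proof. by elim: n x => //= n IHn x; rewrite scaled_plateauD1. Qed.

Lemma staircase_step (n : nat) x :
  `|staircase n.+1 x - staircase n x| <= 2^-1 ^+ n.
Proof.
(* Growth by 100 is more than 16 per step, so the step is at most 8^n / 16^n, which is summable. *)
have q_ge : 16 ^+ n <= (q n)%:R :> R.
  elim: n => [|n IHn]; first by rewrite expr0 ler1n.
  by rewrite exprS; have := qS n; have := q0 n; lra.
rewrite (le_trans (staircase_dist n _ _))//.
rewrite (@le_trans _ _ (8 ^+ n * (16 ^+ n)^-1))//.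
  rewrite ler_pM2l ?exprn_gt0// (le_trans (scaled_plateau_dist _ _ (q_gt0 n)))//.
  by rewrite lef_pV2 ?posrE ?exprn_gt0.
by rewrite -exprVn -exprMn lerXn2r ?nnegrE; lra.
Qed.

(** This is the pointwise limit. As steps are at most 2^-n, subtracting the tail sum 2 * 2^-n makes
    the sequence nondecreasing, and adding it makes a nonincreasing one; the limit lies in all these
    nested intervals. *)
Definition staircase_lim x : R :=
  sup (range (fun n => staircase n x - 2 * 2^-1 ^+ n)).

Lemma staircase_lim_dist (n : nat) x :
  `|staircase_lim x - staircase n x| <= 2 * 2^-1 ^+ n.
Proof.
pose L n := staircase n x - 2 * 2^-1 ^+ n.
pose U n := staircase n x + 2 * 2^-1 ^+ n.
have step m : L m <= L m.+1 /\ U m.+1 <= U m.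
  have := staircase_step m x; rewrite ler_norml /L /U exprS => /andP[? ?].
  by split; lra.
have L_le : {homo L : i j / (i <= j)%N >-> i <= j}.
  by apply/nondecreasing_seqP => m; case: (step m).
have U_le : {homo U : i j / (i <= j)%N >-> j <= i}.
  by apply/nonincreasing_seqP => m; case: (step m).
have LU m k : L m <= U k.
  rewrite (le_trans (L_le _ _ (leq_maxl m k)))//.
  rewrite (le_trans _ (U_le _ _ (leq_maxr m k)))// /L /U.
  have : 0 <= 2^-1 ^+ maxn m k :> R by rewrite exprn_ge0.
  lra.
have L_ub k : ubound (range L) (U k) by move=> _ [m _ <-].
have : L n <= staircase_lim x.
  by apply: ub_le_sup; [exists (U n)|exists n].
have : staircase_lim x <= U n by apply: ge_sup => //; exists (L 0%N), 0%N.
rewrite ler_norml /L /U => ? ?; apply/andP; split; lra.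
Qed.

(** Transfers to the limit what holds for every [staircase n]. The constant 4 in its uses covers two
    approximation errors of 2 * 2^-n each. *)
Lemma le0_geometric (u c : R) : (forall n, u <= c * 2^-1 ^+ n) -> u <= 0.
Proof.
move=> u_le; rewrite leNgt; apply/negP => u_gt0.
have c_gt0 : 0 < c by rewrite (lt_le_trans u_gt0)// (le_trans (u_le 0%N))// expr0 mulr1.
have := archi_boundP (ltW (divr_gt0 c_gt0 u_gt0)).
set n := Num.bound _ => c_lt.
have : c * 2^-1 ^+ n < u.
  rewrite exprVn ltr_pdivrMr ?exprn_gt0// mulrC -ltr_pdivrMr//.
  by rewrite (lt_trans c_lt)// -natrX ltr_nat ltn_expl.
by rewrite ltNge u_le.
Qed.

Lemma staircase_lim_nd : {homo staircase_lim : x y / x <= y}.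
Proof.
move=> x y le_xy; rewrite -subr_le0; apply: (@le0_geometric _ 4) => n.
have /andP[? _] := staircase_lip n _ _ le_xy.
have := staircase_lim_dist n x; have := staircase_lim_dist n y.
by rewrite !ler_norml => /andP[? ?] /andP[? ?]; lra.
Qed.

Lemma staircase_limD1 x : staircase_lim (x + 1) = staircase_lim x + 1.
Proof.
apply/eqP; rewrite -subr_eq0 -normr_le0; apply: (@le0_geometric _ 4) => n.
have := staircase_lim_dist n x; have := staircase_lim_dist n (x + 1).
rewrite staircaseD1 !ler_norml => /andP[? ?] /andP[? ?].
by apply/andP; split; lra.
Qed.

Lemma staircase_lim_continuous : continuous staircase_lim.
Proof.
move=> x; apply/cvgrPdist_le => /= e e_gt0.
(* The two approximation errors then take at most e/2 together; the Lipschitz bound of [staircase n]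
   takes the other e/2. *)
have [n n_lt] : exists n, 8 * 2^-1 ^+ n <= e.
  apply: contrapT => /forallNP e_lt; suff : e <= 0 by rewrite leNgt e_gt0.
  by apply: (@le0_geometric _ 8) => n; have /negP := e_lt n; rewrite -ltNge => /ltW.
have p8 : 0 < 8 ^+ n :> R by rewrite exprn_gt0.
near=> y.
have : `|x - y| <= e / 2 / 8 ^+ n.
  by near: y; apply: cvgr_dist_le => //; rewrite !divr_gt0.
rewrite ler_pdivlMr// mulrC => xy_le.
have := le_trans (staircase_dist n x y) xy_le.
have := staircase_lim_dist n x; have := staircase_lim_dist n y.
rewrite !ler_norml => /andP[? ?] /andP[? ?] /andP[? ?].
by apply/andP; split; lra.
Unshelve. all: by end_near. Qed.

(* The maps applied before the one of scale [q m] move points by at most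
   [\sum_(k > m) (q k)^-1], which is absorbed by shrinking the plateaux of
   length [7/8] to length [3/4]. *)
Lemma staircase_flat (m n : nat) (j : int) x : (m < n)%N ->
  (j%:~R - 16^-1) / (q m)%:R - 2 / (q n)%:R <= x
    <= (j%:~R + 11 / 16) / (q m)%:R + 2 / (q n)%:R ->
  staircase n x = staircase m (j%:~R / (q m)%:R).
Proof.
have inv_qS k : 100 * (q k.+1)%:R^-1 <= (q k)%:R^-1 :> R.
  by rewrite -ler_pdivlMl// -invfM lef_pV2 ?posrE ?mulr_gt0.
elim: n x => // n IHn x; rewrite ltnS leq_eqVlt => /predU1P[<-{n IHn}|lt_mn] /=.
  move=> /andP[jx xj]; rewrite (scaled_plateau_int _ j)//.
  have := inv_qS m; have : 0 < (q m)%:R^-1 :> R by rewrite invr_gt0.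
  by move=> ? ?; apply/andP; split; lra.
(* The slack closes up: 1/q_n + 2/q_(n+1) <= 2/q_n. *)
move=> /andP[jx xj]; apply: IHn => //.
have := scaled_plateau_dist _ x (q_gt0 n); rewrite ler_norml => /andP[? ?].
have := inv_qS n; have : 0 < (q n)%:R^-1 :> R by rewrite invr_gt0.
by move=> ? ?; apply/andP; split; lra.
Qed.

(** On this interval every [staircase n] with n > m has the same value, [staircase m] at j/q_m,
    hence so does the limit. The point j/q_m lies in the interval too, which gives the stated
    form. *)
Lemma staircase_lim_flat (m : nat) (j : int) x :
  (j%:~R - 16^-1) / (q m)%:R <= x <= (j%:~R + 11 / 16) / (q m)%:R ->
  staircase_lim x = staircase_lim (j%:~R / (q m)%:R).
Proof.
suff flat y : (j%:~R - 16^-1) / (q m)%:R <= y <= (j%:~R + 11 / 16) / (q m)%:R ->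
    staircase_lim y = staircase m (j%:~R / (q m)%:R).
  move=> /flat->; rewrite flat//.
  by have : 0 < (q m)%:R^-1 :> R; [rewrite invr_gt0|move=> ?; apply/andP; split; lra].
move=> /andP[jy yj].
apply/eqP; rewrite -subr_eq0 -normr_le0; apply: (@le0_geometric _ 4) => n.
(* The index m + n + 1 exceeds m, as [staircase_flat] requires, and its error is still of order
   2^-n. *)
have le_n : 2^-1 ^+ (m + n).+1 <= 2^-1 ^+ n :> R.
  by rewrite ler_wiXn2l ?(leqW (leq_addl _ _))//; lra.
rewrite -(@staircase_flat m (m + n).+1 j y) ?ltnS ?leq_addr//.
  by rewrite (le_trans (staircase_lim_dist _ _))//; have : 0 <= 2^-1 ^+ n :> R; [rewrite exprn_ge0|lra].
have : 0 < (q (m + n).+1)%:R^-1 :> R by rewrite invr_gt0.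
by move=> ?; apply/andP; split; lra.
Qed.

End limit.
End devil_staircase.

(** * Integrals of continuous functions and of monotone functions with plateaux *)

Section continuous_Rintegral.
Context {R : realType}.
Variable f : R -> R.
Hypothesis f_cont : continuous f.
Notation mu := (@lebesgue_measure R).

Lemma continuous_itv_integrable (a b : R) : mu.-integrable `[a, b] (EFin \o f).
Proof.
apply: continuous_compact_integrable; first exact: segment_compact.
exact: continuous_subspaceT.
Qed.

Lemma Rintegral_itv_split (a b c : R) : a <= b -> b <= c ->
  \int[mu]_(x in `[a, c]) f x
    = \int[mu]_(x in `[a, b]) f x + \int[mu]_(x in `[b, c]) f x.
Proof.
move=> le_ab le_bc; apply/eqP; rewrite addrC -subr_eq; apply/eqP.
rewrite Rintegral_itvB ?bnd_simp//; last exact: continuous_itv_integrable.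
apply: Rintegral_itv_obnd_cbnd; apply: integrableS (continuous_itv_integrable b c) => //.
exact: subset_itv_oc_cc.
Qed.

Lemma Rintegral_itv_le (a b M : R) : a <= b ->
  (forall x, a <= x <= b -> f x <= M) ->
  \int[mu]_(x in `[a, b]) f x <= M * (b - a).
Proof.
move=> le_ab f_le.
apply: (@le_trans _ _ (\int[mu]_(x in `[a, b]) cst M x)).
  apply: le_Rintegral => //; first exact: continuous_itv_integrable.
    apply: continuous_compact_integrable; first exact: segment_compact.
    by apply: continuous_subspaceT => x; exact: cvg_cst.
rewrite Rintegral_cst//.
suff -> : b - a = fine (mu `[a, b]) by [].
rewrite lebesgue_measure_itv/= lte_fin; move: le_ab.
by rewrite le_eqVlt => /predU1P[->|->//]; rewrite ltxx subrr.
Qed.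

(** On each cell, f is at most its left value on 11/16 of the length and its right value on the
    remaining 5/16. The excess over the left value is 5/16 of the increment of f, and the increments
    telescope. *)
Lemma Rintegral_le_plateaux (Q : nat) : (0 < Q)%N ->
  {homo f : x y / x <= y} ->
  (forall j : nat, f ((j%:R + 11 / 16) / Q%:R) = f (j%:R / Q%:R)) ->
  Q%:R * \int[mu]_(x in `[0, 1]) f x
    <= \sum_(0 <= j < Q) f (j%:R / Q%:R) + 5 / 16 * (f 1 - f 0).
Proof.
move=> Q_gt0 f_nd f_flat; have Q0 : 0 < Q%:R :> R by rewrite ltr0n.
suff int_le k : Q%:R * \int[mu]_(x in `[0, k%:R / Q%:R]) f x
    <= \sum_(0 <= j < k) f (j%:R / Q%:R) + 5 / 16 * (f (k%:R / Q%:R) - f 0).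
  by have := int_le Q; rewrite divff ?gt_eqF.
elim: k => [|k IHk].
  by rewrite mul0r set_itv1 Rintegral_set1 big_geq// subrr !mulr0 addr0.
pose x : R := k%:R / Q%:R; pose y : R := (k%:R + 11 / 16) / Q%:R.
pose z : R := k.+1%:R / Q%:R.
have V_gt0 : 0 < Q%:R^-1 :> R by rewrite invr_gt0.
have yx : y - x = 11 / 16 * Q%:R^-1 by rewrite /x /y; field; lra.
have zy : z - y = 5 / 16 * Q%:R^-1 by rewrite /z /y -natr1; field; lra.
have x_ge0 : 0 <= x by rewrite /x divr_ge0.
have le_xy : x <= y by lra.
have le_yz : y <= z by lra.
rewrite big_nat_recr//= -/x -/z (@Rintegral_itv_split 0 x z)//; last lra.
rewrite (@Rintegral_itv_split x y z)//.
have I1 : \int[mu]_(t in `[x, y]) f t <= f x * (y - x).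
  by apply: Rintegral_itv_le => // t /andP[_ ty]; rewrite -f_flat f_nd.
have I2 : \int[mu]_(t in `[y, z]) f t <= f z * (z - y).
  by apply: Rintegral_itv_le => // t /andP[_ tz]; rewrite f_nd.
have {}I1 : Q%:R * \int[mu]_(t in `[x, y]) f t <= 11 / 16 * f x.
  by rewrite -ler_pdivlMl//; move: I1; rewrite yx; lra.
have {}I2 : Q%:R * \int[mu]_(t in `[y, z]) f t <= 5 / 16 * f z.
  by rewrite -ler_pdivlMl//; move: I2; rewrite zy; lra.
move: IHk; rewrite -/x !mulrDr; lra.
Qed.

End continuous_Rintegral.

Lemma continuous_onem (R : realType) : continuous (fun x : R => 1 - x).
Proof. by move=> x; apply: cvgB; [exact: cvg_cst|exact: cvg_id]. Qed.

(** Using 1 - x for -x only changes the constant; it has integral 1/2, an instance of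
    [Rintegral_onemXn]. *)
Lemma integral_centered_eq0 (R : realType) (f : R -> R) : continuous f ->
  (\int[@lebesgue_measure R]_(x in `[0%R, 1%R])
     (f x + (1 - x) - (\int[lebesgue_measure]_(t in `[0, 1]) f t + 2^-1))%:E
   = 0)%E.
Proof.
move=> f_cont; set c := (_ + 2^-1)%R.
have cst_cont : continuous (fun _ : R => c) by move=> x; exact: cvg_cst.
have onem_cont := continuous_onem R.
have sum_cont : continuous (fun x => f x + (1 - x)).
  by move=> x; apply: cvgD; [exact: f_cont|exact: onem_cont].
have g_cont : continuous (fun x => f x + (1 - x) - c).
  by move=> x; apply: cvgB; [exact: sum_cont|exact: cst_cont].
rewrite -[LHS]fineK; last first.
  by apply: integrable_fin_num => //; exact: (continuous_itv_integrable _ g_cont).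
congr EFin; rewrite -[LHS]/(\int[lebesgue_measure]_(x in `[0, 1]) (f x + (1 - x) - c)).
rewrite RintegralB//; [|exact: (continuous_itv_integrable _ sum_cont)
                       |exact: (continuous_itv_integrable _ cst_cont)].
rewrite RintegralD//; [|exact: (continuous_itv_integrable _ f_cont)
                       |exact: (continuous_itv_integrable _ onem_cont)].
have -> : \int[lebesgue_measure]_(x in `[0, 1]) (1 - x) = 2^-1 :> R.
  by have := @Rintegral_onemXn R 1.
rewrite Rintegral_cst//.
suff -> : fine (@lebesgue_measure R `[0, 1]) = 1 by rewrite mulr1 subrr.
by rewrite lebesgue_measure_itv/= lte_fin ltr01 oppr0 addr0.
Qed.

(** * Birkhoff sums along a rational approximation *)

Section birkhoff_sum.
Context {R : realType}.
Notation mu := (@lebesgue_measure R).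

Lemma periodic_int (f : R -> R) (k : int) (x : R) :
  periodic f 1 -> f (x + k%:~R) = f x.
Proof.
move=> f_per; case: k => n; first exact: (periodicn f_per n x).
rewrite NegzE mulrNz -[in RHS](subrK n.+1%:~R x).
by symmetry; exact: (periodicn f_per n.+1 (x - n.+1%:~R)).
Qed.

(** Multiplication by P permutes the residues modulo Q, and periodicity discards the integer
    quotients. *)
Lemma sum_periodic_coprime (f : R -> R) (P : int) (Q : nat) :
  periodic f 1 -> (0 < Q)%N -> coprime `|P| Q ->
  \sum_(0 <= k < Q) f ((k%:Z * P)%:~R / Q%:R)
    = \sum_(0 <= k < Q) f (k%:R / Q%:R).
Proof.
move=> f_per; case: Q => // Q _ cop; rewrite !big_mkord.
pose h (k : 'I_Q.+1) : 'I_Q.+1 := inord `|(k%:Z * P %% Q.+1)%Z|.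
have hE k : (h k)%:Z = (k%:Z * P %% Q.+1)%Z.
  have mod_ge0 : (0 <= (k%:Z * P %% Q.+1)%Z)%R by rewrite modz_ge0.
  rewrite /h inordK ?gez0_abs// -ltz_nat gez0_abs//.
  exact: ltz_pmod.
have h_inj : injective h.
  move=> k l hkl; have := congr1 (fun i : 'I_Q.+1 => (i : nat)%:Z) hkl; rewrite !hE => /eqP.
  rewrite eqz_mod_dvd -mulrBl Gauss_dvdzl; last first.
    by rewrite coprimezE coprime_sym.
  rewrite -eqz_mod_dvd => /eqP; rewrite !modz_small ?ltz_nat ?ltn_ord// => -[].
  by move=> /ord_inj.
rewrite [RHS](reindex_inj h_inj); apply: eq_bigr => k _.
rewrite {1}(divz_eq (k%:Z * P) Q.+1) -hE intrD intrM mulrDl addrC.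
by rewrite mulfK ?pnatr_eq0// periodic_int.
Qed.

Lemma sum_nat_id (n : nat) : \sum_(0 <= k < n) k%:R = n%:R * (n%:R - 1) / 2 :> R.
Proof.
elim: n => [|n IHn]; first by rewrite big_geq// !mul0r.
by rewrite big_nat_recr//= IHn -natr1; field.
Qed.

Lemma birkhoff_sum_ge (F : R -> R) (theta : R) (P : int) (Q : nat) :
  continuous F -> {homo F : x y / x <= y} -> (forall x, F (x + 1) = F x + 1) ->
  (0 < Q)%N -> coprime `|P| Q ->
  (forall (j : int) x, (j%:~R - 16^-1) / Q%:R <= x <= (j%:~R + 11 / 16) / Q%:R ->
    F x = F (j%:~R / Q%:R)) ->
  `|theta - P%:~R / Q%:R| <= (100 * Q%:R ^+ 2)^-1 ->
  8^-1 <= \sum_(0 <= k < Q)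
    (F (k%:R * theta) + (1 - k%:R * theta)
       - (\int[mu]_(x in `[0, 1]) F x + 2^-1)).
Proof.
move=> F_cont F_nd F1 Q_gt0 cop F_flat.
set delta := theta - _ => delta_le.
have Q0 : 0 < Q%:R :> R by rewrite ltr0n.
have Q1 : 1 <= Q%:R :> R by rewrite ler1n.
have V_gt0 : 0 < Q%:R^-1 :> R by rewrite invr_gt0.
have int_le : Q%:R * \int[mu]_(x in `[0, 1]) F x
    <= \sum_(0 <= j < Q) F (j%:R / Q%:R) + 5 / 16 * (F 1 - F 0).
  apply: Rintegral_le_plateaux => // j; rewrite (F_flat j)// -pmulrn.
  by rewrite lexx andbT ler_pM2r//; lra.
have F10 : F 1 - F 0 = 1 by have := F1 0; rewrite add0r => ->; lra.
pose I := \int[mu]_(x in `[0, 1]) F x.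
(* F has degree one and is not periodic; F(x) - x is, so the points kP/Q can be permuted. *)
pose G x := F x - x.
have G_per : periodic G 1 by move=> x; rewrite /G F1; lra.
(* The point k theta is within 1/(100 Q) of kP/Q, hence on the same plateau: F does not see the
   drift k delta, which survives only in the linear term. *)
have termE k : (k < Q)%N -> F (k%:R * theta) + (1 - k%:R * theta) - (I + 2^-1)
    = G ((k%:Z * P)%:~R / Q%:R) - delta * k%:R - (I - 2^-1).
  move=> lt_kQ; have k_le : k%:R <= Q%:R :> R by rewrite ler_nat ltnW.
  have kE : k%:R * theta = (k%:Z * P)%:~R / Q%:R + delta * k%:R.
    by rewrite /delta intrM -pmulrn; ring.
  have kd : `|delta * k%:R| <= 100^-1 * Q%:R^-1.
    have -> : 100^-1 * Q%:R^-1 = (100 * Q%:R ^+ 2)^-1 * Q%:R :> R by field; lra.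
    by rewrite normrM normr_nat ler_pM.
  rewrite (F_flat (k%:Z * P)); first by rewrite /G kE; lra.
  move: kd; rewrite kE ler_norml => /andP[? ?].
  by rewrite !mulrDl mulNr; apply/andP; split; lra.
rewrite -/I (eq_big_nat _ _ (F2 := fun k =>
    G ((k%:Z * P)%:~R / Q%:R) - delta * k%:R - (I - 2^-1))); last first.
  by move=> k /andP[_ /termE].
rewrite 2!sumrB (sum_periodic_coprime G)// -mulr_sumr sum_nat_id.
rewrite sumr_const_nat subn0 /G sumrB -mulr_suml sum_nat_id -[(I - _) *+ Q]mulr_natl.
have dQ : delta * (Q%:R * (Q%:R - 1) / 2) <= 200^-1.
  have -> : 200^-1 = (100 * Q%:R ^+ 2)^-1 * (Q%:R ^+ 2 / 2) :> R by field; lra.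
  rewrite (le_trans (ler_norm _))// normrM ler_pM// ger0_norm.
    by rewrite ler_pM2r// expr2 ler_pM2l//; lra.
  by rewrite divr_ge0// mulr_ge0 ?subr_ge0.
have -> : Q%:R * (Q%:R - 1) / 2 / Q%:R = (Q%:R - 1) / 2 :> R by field; lra.
(* The sum is at least 1/2 - 5/16 - 1/200, which exceeds 1/8; the 1/2 is Q/2 - (Q - 1)/2. *)
move: int_le; rewrite F10 -/I; lra.
Qed.

End birkhoff_sum.

(** * The lower limit and the construction of g *)

Lemma limn_einf_ge (R : realType) (u : nat -> \bar R) (l : \bar R) (N : nat) :
  (forall n, (N <= n)%N -> l <= u n)%E -> (l <= limn_einf u)%E.
Proof.
move=> u_ge; rewrite limn_einf_lim; apply: lime_ge; first exact: is_cvg_einfs.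
near=> n; apply: le_ereal_inf_tmp => _ [m /= le_nm <-]; apply: u_ge.
by apply: leq_trans le_nm; near: n; exact: nbhs_infty_ge.
Unshelve. all: by end_near. Qed.

Theorem theorem2 (R : realType) (theta : R) (a : nat -> int)
  (theta_irr : irrational theta)
  (theta_cf : is_cfrac_expansion theta a)
  (a0 : a 0%N = 0) (a1 : a 1%N = 1) (a2 : a 2%N = 1)
  (lim0 : ((cfrac_den a nu.-1)%:R / (a nu.+1)%:~R : R) @[nu --> \oo]
            --> (0 : R)) :
  exists g : R -> R,
    [/\ continuous g,
        periodic g 1,
        bounded_variation 0 1 g,
        (\int[lebesgue_measure]_(x in `[0%R, 1%R]) (g x)%:E = 0)%E
      & (0 < limn_einf (fun nu : nat =>
           (\sum_(0 <= k < cfrac_den a nu) g (k%:R * theta))%R%:E))%E].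
Proof.
have a_gt0 := theta_cf.1.
(* Since Q_(nu-1) >= 1, a ratio below 1/100 forces a_(nu+1) > 100. *)
have [N a_ge] : exists N, forall nu, (N <= nu)%N -> 100 <= a nu.+1.
  have /cvgrPdist_lt /(_ 100^-1) [|N _ small] := lim0; first by rewrite invr_gt0.
  exists N => nu /small /=; rewrite sub0r normrN.
  have ap : 0 < (a nu.+1)%:~R :> R by rewrite ltr0z a_gt0.
  have : 1 <= (cfrac_den a nu.-1)%:R :> R by rewrite ler1n cfrac_den_gt0.
  rewrite normrM normfV normr_nat (gtr0_norm ap) ltr_pdivrMr// => ? ?.
  by rewrite -(ler_int R); lra.
(* Starting at N gives growth by 100 at every index; a lower limit depends only on the tail. *)
pose q n := cfrac_den a (N + n).
have q_gt0 n : (0 < q n)%N := cfrac_den_gt0 a (N + n).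
have q_growth n : (100 * q n <= q n.+1)%N.
  rewrite -lez_nat PoszM /q addnS (le_trans _ (cfrac_den_growth _ _ a_gt0))//.
  by rewrite ler_pM2r ?ltz_nat ?cfrac_den_gt0// a_ge ?leq_addr.
pose F : R -> R := staircase_lim q.
have F_cont : continuous F := staircase_lim_continuous q q_gt0 q_growth.
have F_nd : {homo F : x y / x <= y} := staircase_lim_nd q q_gt0 q_growth.
have F1 x : F (x + 1) = F x + 1 := staircase_limD1 q q_gt0 q_growth x.
pose c := \int[lebesgue_measure]_(x in `[0, 1]) F x + 2^-1.
exists (fun x => F x + (1 - x) - c); split.
- move=> x; apply: cvgB; last exact: cvg_cst.
  apply: cvgD; first exact: F_cont.
  by apply: cvgB; [exact: cvg_cst|exact: cvg_id].
- by move=> x; rewrite F1; lra.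
(* A difference of two nondecreasing functions has bounded variation. *)
- have -> : (fun x => F x + (1 - x) - c) = F \+ (\- (fun x => x + (c - 1))).
    by apply/funext => x /=; lra.
  apply: bounded_variationD => //.
    by apply: nondecreasing_bounded_variation => x y _ _; exact: F_nd.
  apply: bounded_variationN; apply: nondecreasing_bounded_variation.
  by move=> x y _ _ le_xy; rewrite lerD2r.
- exact: integral_centered_eq0.
- apply: (@lt_le_trans _ _ (8^-1)%:E); first by rewrite lte_fin invr_gt0.
  apply: (@limn_einf_ge _ _ _ N) => nu le_Nnu; rewrite lee_fin.
  have nuE : cfrac_den a nu = q (nu - N)%N by rewrite /q subnKC.
  have nuSE : cfrac_den a nu.+1 = q (nu - N).+1 by rewrite /q addnS subnKC.
  apply: (@birkhoff_sum_ge _ F theta (numq (cfrac a nu))) => //.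
  + exact: cfrac_den_gt0.
  + exact: coprime_numq_cfrac_den.
  + by move=> j x; rewrite nuE; exact: staircase_lim_flat.
  (* The error 1/(Q_nu Q_(nu+1)) is at most 1/(100 Q_nu^2) by the growth of q. *)
  apply: (le_trans (cfrac_approx _ _ _ nu theta_cf)); rewrite nuE nuSE.
  have q0 n : 0 < (q n)%:R :> R by rewrite ltr0n.
  rewrite lef_pV2 ?posrE ?mulr_gt0 ?exprn_gt0// expr2 mulrCA ler_pM2l//.
  by rewrite -natrM ler_nat.
Qed.
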